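(* Let $f:\mathbb{R}^n\to\mathbb{R}$ be convex and $L$-smooth, let $g:\mathbb{R}^n\to\mathbb{R}^{n_{\rm g}}$ be concave and $L_g$-smooth, and let $\nabla^2f(x^* )-\sum_{i=1}^{n_{\rm g}}\lambda_i^*\nabla^2g_i(x^* )$ be positive definite, where $x^*$ is a minimizer and $\lambda^*$ an optimal multiplier of $\min_{x\in\mathbb{R}^n}f(x)$ s.t. $g(x)\ge 0$. Let $L_l$ denote the smoothness constant of the Lagrangian $l(x)=f(x)-g(x)^{T}\lambda^*$. For $N$ and $x_0\in\mathbb{R}^n$ consider the modified objective function $$f_\mu(x)=f(x)+\mu|x-x_0|^2/2\qquad\text{with}\qquad \mu=\frac{16L_l\log(N)^2}{N^2}.$$ Let $x_N$ be the $N$-th iterate, starting from $x_0$ and $u_0=0$, of $$y_k=x_k+\beta u_k,$$ $$u_{k+1}=\operatorname*{argmin}_{v\in\mathbb{R}^n}\tfrac12\big|v-u_k+2\delta T_ku_k+\nabla f_\mu(y_k)T_k\big|^2$$ $$\text{s.t.}\quad \nabla g_i(y_k)^{T}v\ \ge\ -\alpha g_i(x_k)-\frac{g_i(y_k)-g_i(x_k)-\nabla g_i(y_k)^{T}\beta u_k}{T_k},\quad i\in\{1,\dots,n_{\rm g}\},$$ $$x_{k+1}=x_k+T_ku_{k+1},$$ with $\kappa_l=L_l/\mu$, $T_k=1/\sqrt{2L_l}$, $\delta=\sqrt{2L_l}/(\sqrt{2\kappa_l}+1)$, $\beta=T_k(1-2\delta T_k)$ and $\alpha=\delta$. Then $$l(x_N)-l(x^*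 )\ \le\ \mathcal{O}\Big(\frac{\log(N)^2}{N^2}\Big).$$
   Context: $L$-smooth means differentiable with $L$-Lipschitz gradient; concavity and smoothness of $g$ are componentwise; the smoothness constant of $l$ is a Lipschitz constant of $\nabla l$. $f$ and $g$ are twice continuously differentiable. Standing assumptions: $f$ is coercive and $C=\{x: g(x)\ge 0\}$ is compact (and nonempty). Optimal multiplier: $\lambda^*\ge0$ with $\nabla f(x^* )=\sum_i\nabla g_i(x^* )\lambda_i^*$ and $\lambda_i^*g_i(x^* )=0$ for all $i$. The $\mathcal{O}$-statement is for $N\to\infty$: the algorithm (whose parameters depend on $N$ through $\mu$) is run for $N$ iterations for each $N$, with $x_0$ fixed. *)

(* Defs.v *)
From HB Require Import structures.
From mathcomp Require Import all_boot all_order all_algebra.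
From mathcomp Require Import all_classical all_reals all_analysis.

Set Implicit Arguments.
Unset Strict Implicit.
Unset Printing Implicit Defensive.

Import Order.TTheory GRing.Theory Num.Theory.
Import numFieldNormedType.Exports.

Local Open Scope classical_set_scope.
Local Open Scope ring_scope.

(* R^n is the type 'cV[R]_n of column vectors.  The norm `|v| that the library
   puts on it is the sup norm; it is used here only through the topology and
   through differentiability, which do not depend on the choice of norm.
   Lipschitz constants and least-squares distances use the Euclidean norm
   enorm. *)

Definition dot (R : realType) (m : nat) (u v : 'cV[R]_m) : R :=
  (u^T *m v) 0 0.

Definition enorm (R : realType) (m : nat) (v : 'cV[R]_m) : R :=
  Num.sqrt (dot v v).

Definition grad (R : realType) (n : nat) (f : 'cV[R]_n -> R)
    (x : 'cV[R]_n) : 'cV[R]_n :=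
  \col_i 'D_(delta_mx i 0) f x.

Definition hess (R : realType) (n : nat) (f : 'cV[R]_n -> R)
    (x : 'cV[R]_n) : 'M[R]_n :=
  \matrix_(i, j) 'D_(delta_mx j 0) (fun y => grad f y i 0) x.

Definition twice_cont_diff (R : realType) (n : nat) (f : 'cV[R]_n -> R) : Prop :=
  [/\ forall x, differentiable f x,
      forall x, differentiable (grad f) x
    & continuous (hess f)].

Definition smooth (R : realType) (n : nat) (L : R) (f : 'cV[R]_n -> R) : Prop :=
  (forall x, differentiable f x) /\
  (forall x y, enorm (grad f x - grad f y) <= L * enorm (x - y)).

Definition convex_fun (R : realType) (n : nat) (f : 'cV[R]_n -> R) : Prop :=
  convex_function [set: 'cV[R]_n] f.

Definition concave_fun (R : realType) (n : nat) (f : 'cV[R]_n -> R) : Prop :=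
  convex_fun (fun x => - f x).

Definition coercive (R : realType) (n : nat) (f : 'cV[R]_n -> R) : Prop :=
  forall A : R, exists r : R, forall x, r <= enorm x -> A <= f x.

(* Symmetry is not part of the definition: below it is applied only to
   combinations of Hessians of C^2 functions. *)
Definition posdef (R : realType) (n : nat) (A : 'M[R]_n) : Prop :=
  forall v : 'cV[R]_n, v != 0 -> 0 < dot v (A *m v).

Definition is_argmin (R : realType) (n : nat) (S : set 'cV[R]_n)
    (F : 'cV[R]_n -> R) (v : 'cV[R]_n) : Prop :=
  S v /\ forall w, S w -> F v <= F w.

Definition gcomp (R : realType) (n ng : nat) (g : 'cV[R]_n -> 'cV[R]_ng)
    (i : 'I_ng) : 'cV[R]_n -> R :=
  fun x => g x i 0.

Definition feasible (R : realType) (n ng : nat) (g : 'cV[R]_n -> 'cV[R]_ng) :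
    set 'cV[R]_n :=
  [set x | forall i, 0 <= gcomp g i x].

Definition lagrangian (R : realType) (n ng : nat) (f : 'cV[R]_n -> R)
    (g : 'cV[R]_n -> 'cV[R]_ng) (lam : 'cV[R]_ng) : 'cV[R]_n -> R :=
  fun x => f x - dot (g x) lam.

Definition optimal_multiplier (R : realType) (n ng : nat) (f : 'cV[R]_n -> R)
    (g : 'cV[R]_n -> 'cV[R]_ng) (xs : 'cV[R]_n) (lam : 'cV[R]_ng) : Prop :=
  [/\ forall i, 0 <= lam i 0,
      grad f xs = \sum_i lam i 0 *: grad (gcomp g i) xs
    & forall i, lam i 0 * gcomp g i xs = 0].

Definition regularized (R : realType) (n : nat) (f : 'cV[R]_n -> R) (mu : R)
    (x0 : 'cV[R]_n) : 'cV[R]_n -> R :=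
  fun x => f x + mu * enorm (x - x0) ^+ 2 / 2.

Definition velocity_set (R : realType) (n ng : nat)
    (g : 'cV[R]_n -> 'cV[R]_ng) (T beta alpha : R) (x u y : 'cV[R]_n) :
    set 'cV[R]_n :=
  [set v | forall i, dot (grad (gcomp g i) y) v >=
     - alpha * gcomp g i x
     - (gcomp g i y - gcomp g i x - dot (grad (gcomp g i) y) (beta *: u)) / T].

Definition velocity_objective (R : realType) (n : nat) (h : 'cV[R]_n -> R)
    (T delta : R) (u y : 'cV[R]_n) : 'cV[R]_n -> R :=
  fun v => 1 / 2 *
    enorm (v - u + (2 * delta * T) *: u + T *: grad h y) ^+ 2.

Definition agd_run (R : realType) (n ng : nat) (h : 'cV[R]_n -> R)
    (g : 'cV[R]_n -> 'cV[R]_ng) (T delta beta alpha : R) (x0 : 'cV[R]_n)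
    (N : nat) (x u : nat -> 'cV[R]_n) : Prop :=
  [/\ x 0%N = x0,
      u 0%N = 0
    & forall k, (k < N)%N ->
        let y := x k + beta *: u k in
        is_argmin (velocity_set g T beta alpha (x k) (u k) y)
                  (velocity_objective h T delta (u k) y) (u k.+1) /\
        x k.+1 = x k + T *: u k.+1].

Definition reg_weight (R : realType) (Ll : R) (N : nat) : R :=
  16 * Ll * ln (N%:R : R) ^+ 2 / N%:R ^+ 2.

Definition step_size (R : realType) (Ll : R) : R := 1 / Num.sqrt (2 * Ll).

Definition damping (R : realType) (Ll mu : R) : R :=
  let kappa := Ll / mu in
  Num.sqrt (2 * Ll) / (Num.sqrt (2 * kappa) + 1).

Definition momentum (R : realType) (Ll mu : R) : R :=
  step_size Ll * (1 - 2 * damping Ll mu * step_size Ll).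

(* The run on the regularized objective, with alpha = delta.  The parameters
   are meaningful for 1 < N, where 0 < mu as soon as 0 < Ll. *)
Definition regularized_run (R : realType) (n ng : nat) (f : 'cV[R]_n -> R)
    (g : 'cV[R]_n -> 'cV[R]_ng) (Ll : R) (x0 : 'cV[R]_n) (N : nat)
    (x u : nat -> 'cV[R]_n) : Prop :=
  let mu := reg_weight Ll N in
  agd_run (regularized f mu x0) g (step_size Ll) (damping Ll mu)
    (momentum Ll mu) (damping Ll mu) x0 N x u.

(* Main.v *)
Require Import Defs.
From HB Require Import structures.
From mathcomp Require Import all_boot all_order all_algebra.
From mathcomp Require Import all_classical all_reals all_analysis.
From mathcomp Require Import ring lra.

Import Order.TTheory GRing.Theory Num.Theory.
Import numFieldNormedType.Exports.

Local Open Scope classical_set_scope.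
Local Open Scope ring_scope.

(** Write [M] for [Ll], [T = 1 / sqrt (2 M)], [th = delta T], [h] for the
regularized objective and [l_mu = h - lam^T g].  In terms of positions the
iteration reads: [x_(k+1)] is the projection of [y_k - T^2 grad h(y_k)] onto the
polyhedron of the [z] with
  [g_i(y_k) + <grad g_i(y_k), z - y_k> >= (1 - th) g_i(x_k)] for all [i],
and [y_k = x_k + (1 - 2 th) (x_k - x_(k-1))]: this is Nesterov's method with step
[1 / (2 M)], projected on a polyhedron that changes with [k].

Two facts tie the moving polyhedron to the fixed problem.  Because [g] is
concave, its linearization at [y_k] overestimates it, so the point
[z = (1 - th) x_k + th xs], where [x_k] itself may be infeasible, always belongs
to the polyhedron ([velocity_set_contracting]); this is where the choice
[alpha = delta] enters.  Because [x_(k+1)] belongs to the polyhedron, the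
linearization of [- lam^T g] at [x_(k+1)] is at most [- (1 - th) lam^T g(x_k)].

Hence the descent inequality of [l_mu], whose smoothness constant is at most
[2 M], bounds [l_mu(x_(k+1))] by the linear model of [h] alone minus
[(1 - th) lam^T g(x_k)].  The variational inequality of the projection, tested
at [z], and the strong convexity of [h] at [x_k] and at [xs] then give, as in the
unconstrained analysis, a contraction of the potential
  [l_mu(x_k) - l_mu(xs) + M |th (x_k - xs) + (1 - th) T u_k|^2]
by the factor [1 - th] ([accelerated_projected_step]).  The multiplier [lam] is
the optimal one throughout, so that neither the multipliers of the projections
nor the amount by which the iterates violate the constraints have to be
controlled.

After [N] steps,
  [l(x_N) - l(xs) <= (1 - th)^N (l(x0) - l(xs)) + mu |xs - x0|^2 / 2].
The second term is a multiple of [ln(N)^2 / N^2] by the choice of [mu]; with that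
choice [th >= 2 ln(N) / N] for large [N], so that [(1 - th)^N <= N^-2].
When [M <= 0] the descent inequality at the stationary point [xs] already gives
[l(x) <= l(xs)] everywhere. *)

(** * The Euclidean inner product *)

Section InnerProduct.
Context {R : realType} {m : nat}.
Implicit Types (u v w : 'cV[R]_m) (a : R).

Lemma dotE u v : dot u v = \sum_i u i 0 * v i 0.
Proof. by rewrite /dot mxE; apply: eq_bigr => i _; rewrite mxE. Qed.

Lemma dotC u v : dot u v = dot v u.
Proof. by rewrite !dotE; apply: eq_bigr => i _; rewrite mulrC. Qed.

Lemma dotDl u v w : dot (u + v) w = dot u w + dot v w.
Proof. by rewrite /dot linearD mulmxDl mxE. Qed.

Lemma dotDr u v w : dot w (u + v) = dot w u + dot w v.
Proof. by rewrite !(dotC w) dotDl. Qed.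

Lemma dotZl a u w : dot (a *: u) w = a * dot u w.
Proof. by rewrite /dot linearZ -scalemxAl mxE. Qed.

Lemma dotZr a u w : dot w (a *: u) = a * dot w u.
Proof. by rewrite !(dotC w) dotZl. Qed.

Lemma dotNl u w : dot (- u) w = - dot u w.
Proof. by rewrite -scaleN1r dotZl mulN1r. Qed.

Lemma dotNr u w : dot w (- u) = - dot w u.
Proof. by rewrite !(dotC w) dotNl. Qed.

Lemma dot_suml (I : finType) (F : I -> 'cV[R]_m) w :
  dot (\sum_i F i) w = \sum_i dot (F i) w.
Proof. by rewrite /dot linear_sum mulmx_suml summxE. Qed.

Definition dot_bilin := (dotDl, dotDr, dotNl, dotNr, dotZl, dotZr).

Lemma dot_ge0 u : 0 <= dot u u.
Proof. by rewrite dotE sumr_ge0 // => i _; rewrite -expr2 sqr_ge0. Qed.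

Lemma sqr_enorm u : enorm u ^+ 2 = dot u u.
Proof. by rewrite sqr_sqrtr ?dot_ge0. Qed.

Lemma enorm_ge0 u : 0 <= enorm u.
Proof. exact: sqrtr_ge0. Qed.

Lemma enormZ a u : 0 <= a -> enorm (a *: u) = a * enorm u.
Proof.
move=> a0; rewrite /enorm dotZl dotZr mulrA -expr2 sqrtrM ?sqr_ge0 //.
by rewrite sqrtr_sqr ger0_norm.
Qed.

(** Cauchy-Schwarz. *)
Lemma dot_le_enorm u v : dot u v <= enorm u * enorm v.
Proof.
have [dv|dv0] := eqVneq (dot v v) 0.
  (* [v] need not be shown to vanish: [|u - t v|^2 >= 0] is affine in [t]. *)
  have key t : 0 <= dot u u - 2 * t * dot u v.
    have := dot_ge0 (u - t *: v).
    rewrite !dot_bilin dv (dotC v u); lra.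
  have -> : dot u v = 0.
    apply/eqP/negPn/negP => uv0.
    have := key ((dot u u + 1) / (2 * dot u v)).
    rewrite (_ : 2 * _ * dot u v = dot u u + 1); first lra.
    by field.
  by rewrite mulr_ge0 ?enorm_ge0.
have dv : 0 < dot v v by rewrite lt_def dv0 dot_ge0.
have : dot u v ^+ 2 <= (enorm u * enorm v) ^+ 2.
  rewrite exprMn !sqr_enorm.
  have := dot_ge0 (dot v v *: u - dot u v *: v).
  rewrite !dot_bilin (dotC v u).
  rewrite (_ : _ + _ = dot v v * (dot u u * dot v v - dot u v ^+ 2)); last by ring.
  by rewrite pmulr_rge0 // subr_ge0.
move=> h; have [//|lt] := leP (dot u v) (enorm u * enorm v).
move: h; rewrite leNgt ltr_pXn2r ?nnegrE ?lt ?mulr_ge0 ?enorm_ge0 //.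
by rewrite (le_trans _ (ltW lt)) // mulr_ge0 ?enorm_ge0.
Qed.

End InnerProduct.

(** * Convexity, smoothness and gradients *)

Section Gradient.
Context {R : realType} {n : nat}.
Implicit Types (f : 'cV[R]_n -> R) (x y v w : 'cV[R]_n).

Lemma derive_dot_grad f x v :
  differentiable f x -> 'D_v f x = dot (grad f x) v.
Proof.
move=> df; rewrite deriveE // [in LHS](matrix_sum_delta v) dotE linear_sum.
apply: eq_bigr => i _; rewrite big_ord1 linearZ /= -deriveE // mxE.
by rewrite mulrC.
Qed.

Lemma is_derive_line f y v (t : R) : differentiable f (y + t *: v) ->
  is_derive t 1 (fun s => f (y + s *: v)) (dot (grad f (y + t *: v)) v).
Proof.
move=> df; have dv : derivable f (y + t *: v) v by exact: diff_derivable.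
have E : (fun h : R => h^-1 *: (((fun s => f (y + s *: v)) \o shift t) (h *: 1)
            - f (y + t *: v))) =
    (fun h => h^-1 *: ((f \o shift (y + t *: v)) (h *: v) - f (y + t *: v))).
  apply/funext => h /=; congr (_ *: (f _ - _)).
  by rewrite [h *: 1]mulr1 scalerDl addrCA.
apply: DeriveDef; first by rewrite /derivable E.
by rewrite -derive_dot_grad // /derive E.
Qed.

Lemma convex_funP f x w (t : R) : convex_fun f -> 0 <= t <= 1 ->
  f (x + t *: (w - x)) <= f x + t * (f w - f x).
Proof.
move=> fc /andP[t0 t1].
have := fc (Itv01 t0 t1) w x (in_setT _) (in_setT _).
rewrite convRE /=.
have -> : conv (Itv01 t0 t1) (w : convex_lmodType 'cV[R]_n) x = x + t *: (w - x).
  by rewrite /conv /= scalerBl scale1r scalerBr addrCA.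
by move=> /le_trans; apply; rewrite mulrBl mul1r mulrBr; lra.
Qed.

(** The difference quotients of a convex function at [0+] in the direction [w - x]
are at most [f w - f x]; so is their limit. *)
Lemma convex_ge_tangent f x w : convex_fun f -> differentiable f x ->
  f x + dot (grad f x) (w - x) <= f w.
Proof.
move=> fc df; rewrite -lerBrDl -derive_dot_grad //.
have dv : derivable f x (w - x) by exact: diff_derivable.
apply: (cvgr_to_le (cvg_dnbhs_at_right dv)).
near=> h.
have h0 : 0 < h by [].
have h1 : h <= 1 by near: h; exact: nbhs_right_le.
rewrite /= [_ *: _]mulrC ler_pdivrMr // lerBlDl addrC (mulrC _ h).
by apply: convex_funP; rewrite ?ltW.
Unshelve. all: by end_near. Qed.

Lemma concave_le_tangent f x w : concave_fun f -> differentiable f x ->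
  f w <= f x + dot (grad f x) (w - x).
Proof.
move=> fc df.
have : - f x + dot (grad (- f) x) (w - x) <= - f w.
  exact: convex_ge_tangent fc (differentiableN df).
rewrite -!derive_dot_grad //; last exact: differentiableN.
rewrite deriveN; last exact: diff_derivable.
by rewrite -opprD lerN2.
Qed.

(** Descent inequality.  It holds for [L] of either sign, since only the function
[phi] below, which subtracts the quadratic model along the segment from [x] to
[w], has to be nonincreasing. *)
Lemma smooth_le_tangent (L : R) f x w : smooth L f ->
  f w <= f x + dot (grad f x) (w - x) + L / 2 * dot (w - x) (w - x).
Proof.
move=> [df Lf]; set v := w - x.
pose a := dot (grad f x) v; pose b := dot v v.
pose phi (t : R) := f (x + t *: v) - (a * t + L / 2 * b * t ^+ 2).
have dphi (t : R) :
    is_derive t 1 phi (dot (grad f (x + t *: v)) v - (a + L * b * t)).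
  have d1 := is_derive_line f x v t (df _).
  have d2 : is_derive t 1 (fun s => a * s + L / 2 * b * s ^+ 2) (a + L * b * t).
    apply: is_derive_eq; rewrite /GRing.scale /=.
    by field.
  exact: (is_deriveB d1 d2).
have : phi 1 <= phi 0.
  apply: (@ler0_derive1_le_cc _ phi 0 1); rewrite ?in_itv /= ?lexx ?ler01 //.
  - move=> t; rewrite in_itv /= => /andP[t0 _].
    rewrite derive1E derive_val.
    have := dot_le_enorm (grad f (x + t *: v) - grad f x) v.
    have := Lf (x + t *: v) x; rewrite addrAC subrr add0r enormZ ?(ltW t0) // => le1 le2.
    have := le_trans le2 (ler_wpM2r (enorm_ge0 v) le1).
    rewrite (_ : L * _ * _ = L * b * t); last by rewrite /b -sqr_enorm; ring.
    rewrite dotDl dotNl -/a; lra.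
  - apply: continuous_subspaceT => t.
    exact/differentiable_continuous/derivable1_diffP.
rewrite /phi scale1r scale0r addr0 /v subrKC -/v -/a -/b; lra.
Qed.

End Gradient.

(** * The Lagrangian and the regularized objective *)

Section Regularization.
Context {R : realType} {n ng : nat}.
Implicit Types (f : 'cV[R]_n -> R) (g : 'cV[R]_n -> 'cV[R]_ng).
Implicit Types (x v w c : 'cV[R]_n) (lam : 'cV[R]_ng).

Lemma lagrangianE f g lam x :
  lagrangian f g lam x = f x - \sum_i lam i 0 * gcomp g i x.
Proof.
by rewrite /lagrangian dotE; congr (_ - _); apply: eq_bigr => i _; rewrite mulrC.
Qed.

Lemma dot_grad_lagrangian f g lam x v : differentiable f x ->
  (forall i, differentiable (gcomp g i) x) ->
  differentiable (lagrangian f g lam) x ->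
  dot (grad (lagrangian f g lam) x) v =
  dot (grad f x) v - \sum_i lam i 0 * dot (grad (gcomp g i) x) v.
Proof.
move=> df dg dl.
have dgi i : derivable (lam i 0 \*: gcomp g i) x v.
  by apply: derivableZ; exact: diff_derivable.
have -> : dot (grad (lagrangian f g lam) x) v =
    'D_v (f - \sum_i (lam i 0 \*: gcomp g i)) x.
  rewrite -derive_dot_grad //; congr ('D_v _ x); apply/funext => z.
  by rewrite lagrangianE /GRing.add /GRing.opp /= fct_sumE.
rewrite deriveB; [|exact: diff_derivable|exact: derivable_sum].
rewrite derive_sum // derive_dot_grad //; congr (_ - _); apply: eq_bigr => i _.
by rewrite deriveZ ?derive_dot_grad //; exact: diff_derivable.
Qed.

(** The difference quotient is affine in the increment [h], namely
[mu <x - c, v> + h (mu / 2) |v|^2]. *)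
Lemma is_derive_sqdist (mu : R) c x v :
  is_derive x v (fun z => mu * enorm (z - c) ^+ 2 / 2) (mu * dot (x - c) v).
Proof.
set q := fun z => _.
suff dq : (fun h : R => h^-1 *: ((q \o shift x) (h *: v) - q x)) @ 0^' -->
    mu * dot (x - c) v.
  by apply: DeriveDef; [apply/cvg_ex; eexists; exact: dq|exact/cvg_lim].
have lin : (fun h : R => mu * dot (x - c) v + h * (mu / 2 * dot v v)) @ 0^' -->
    mu * dot (x - c) v.
  rewrite -[X in _ --> X]addr0 -[X in _ --> _ + X](mul0r (mu / 2 * dot v v)).
  apply: cvgD; first exact: cvg_cst.
  by apply: cvgM; [exact: nbhs_dnbhs|exact: cvg_cst].
apply: cvg_trans lin; apply: near_eq_cvg; near=> h.
have h0 : h != 0 by near: h; exact: nbhs_dnbhs_neq.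
rewrite /q /= !sqr_enorm -addrA [_ *: _]mulrC !dot_bilin (dotC v x) (dotC v c).
by rewrite (dotC c x); field.
Unshelve. all: by end_near. Qed.

Lemma grad_regularized f (mu : R) c x : differentiable f x ->
  grad (regularized f mu c) x = grad f x + mu *: (x - c).
Proof.
move=> df; apply/matrixP => i j; rewrite (ord1 j) !mxE.
have dq := is_derive_sqdist mu c x (delta_mx i 0).
have dfi : derivable f x (delta_mx i 0) by exact: diff_derivable.
have -> : regularized f mu c = f + (fun z => mu * enorm (z - c) ^+ 2 / 2) by [].
rewrite deriveD // derive_val; congr (_ + _ * _).
rewrite dotC dotE (bigD1 i) //= big1 => [|k ki].
  by rewrite mxE !eqxx mul1r addr0 !mxE.
by rewrite mxE (negbTE ki) mul0r.
Qed.

(** The quadratic term equals its own second-order expansion at [x], so the whole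
gain over the tangent inequality of [f] is its remainder. *)
Lemma regularized_strongly_convex f (mu : R) c x w :
  convex_fun f -> differentiable f x ->
  regularized f mu c x + dot (grad (regularized f mu c) x) (w - x)
    + mu / 2 * dot (w - x) (w - x) <= regularized f mu c w.
Proof.
move=> fc df; have := convex_ge_tangent f x w fc df.
rewrite grad_regularized // /regularized !sqr_enorm [dot (_ + _ *: _) _]dotDl dotZl.
have -> : w - c = (w - x) + (x - c) by rewrite addrA subrK.
move: (w - x) (x - c) => a b; rewrite !dot_bilin (dotC b a); lra.
Qed.

End Regularization.

(** * One accelerated projected step *)

Section Step.
Context {R : realType} {n ng : nat}.
Implicit Types (f : 'cV[R]_n -> R) (g : 'cV[R]_n -> 'cV[R]_ng).
Implicit Types (x y u v w p d c : 'cV[R]_n) (lam : 'cV[R]_ng).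

(** Variational inequality of a projection, here of [- c] onto a set that is
star-shaped at [v] in the direction of [w]. *)
Lemma argmin_sqdist_variational (S : set 'cV[R]_n) c v w :
  (forall t : R, 0 <= t <= 1 -> S (v + t *: (w - v))) ->
  is_argmin S (fun z => 1 / 2 * enorm (z + c) ^+ 2) v ->
  0 <= dot (v + c) (w - v).
Proof.
move=> seg [Sv vmin]; rewrite leNgt; apply/negP => lt0.
set e := dot (v + c) (w - v) in lt0 *.
set D := dot (w - v) (w - v); have D0 : 0 <= D := dot_ge0 _.
have eD : 0 < D - e by lra.
(* With this step [t] the increment [2 t e + t^2 D] equals [t (1 + t) e < 0]. *)
pose t := - e / (D - e).
have t0 : 0 < t by rewrite divr_gt0 ?oppr_gt0.
have t1 : t <= 1 by rewrite ler_pdivrMr //; lra.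
have tD : t * (D - e) = - e by rewrite /t mulfVK ?gt_eqF.
have := vmin _ (seg t _); rewrite (ltW t0) t1 => /(_ isT).
have -> : v + t *: (w - v) + c = (v + c) + t *: (w - v) by rewrite addrAC.
have expand a b : dot (a + t *: b) (a + t *: b) =
    dot a a + t * (2 * dot a b + t * dot b b).
  by rewrite !dot_bilin (dotC b a); ring.
rewrite !sqr_enorm expand -/e -/D.
have te : t * e < 0 by rewrite pmulr_rlt0.
have : t * (2 * e + t * D) < 0.
  by rewrite pmulr_rlt0 //; move: tD; rewrite mulrBr; lra.
lra.
Qed.

Lemma velocity_set_segment g (T beta alpha : R) x u y v w :
  velocity_set g T beta alpha x u y v -> velocity_set g T beta alpha x u y w ->
  forall t : R, 0 <= t <= 1 ->
  velocity_set g T beta alpha x u y (v + t *: (w - v)).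
Proof.
move=> Sv Sw t /andP[t0 t1] i; have := Sv i; have := Sw i.
rewrite /= (dotDr v) (dotZr t) (dotDr w) dotNr.
move: (dot _ w) (dot _ v) (_ - _ / T) => W V c cW cV.
have := ler_wpM2l t0 cW; have : (1 - t) * c <= (1 - t) * V.
  by rewrite ler_wpM2l // subr_ge0.
lra.
Qed.

(** The velocity [delta (xs - x)] leads from [x] to
[(1 - delta T) x + delta T xs].  Put [a = g y - g x - <grad g y, beta u>], which is
nonnegative by concavity.  The tangent inequality at [y] towards the feasible
point [xs] yields [<grad g y, delta (xs - x)> >= - delta (g x + a)], and the
constraint only asks for [- delta g x - a / T].  The sign of [g x] does not enter
because the coefficient of [g x] in the constraint is exactly [delta]. *)
Lemma velocity_set_contracting g (T beta delta : R) x u xs :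
  (forall i, concave_fun (gcomp g i)) ->
  (forall i z, differentiable (gcomp g i) z) ->
  0 < T -> 0 <= delta -> delta * T <= 1 -> feasible g xs ->
  velocity_set g T beta delta x u (x + beta *: u) (delta *: (xs - x)).
Proof.
move=> gc dg T0 d0 dT fxs i; set y := x + beta *: u.
have gs := fxs i.
have := concave_le_tangent _ y xs (gc i) (dg i y).
have := concave_le_tangent _ y x (gc i) (dg i y).
rewrite (_ : x - y = - (beta *: u)); last by rewrite /y opprD addrA subrr sub0r.
rewrite (_ : xs - y = (xs - x) - beta *: u); last by rewrite /y opprD addrA.
rewrite [dot _ (delta *: _)]dotZr !(dotNr, dotDr _ (- (beta *: u))).
move: (dot _ (xs - x)) (dot _ (beta *: u)) (gcomp g i x) (gcomp g i y) gs.
move=> A B gx gy gs a0 sA.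
pose a := gy - gx - B; have {}a0 : 0 <= a by rewrite /a; lra.
rewrite -/a /=.
have : delta * a <= a / T.
  by rewrite ler_pdivlMr // mulrAC ler_piMl.
have : delta * (- (a + gx)) <= delta * A by rewrite ler_wpM2l //; rewrite /a; lra.
lra.
Qed.

(** The velocity constraint multiplied by [T]: a bound on the linearization of [g]
at the new position. *)
Lemma velocity_set_linearization g (T beta alpha : R) x u w i : 0 < T ->
  let y := x + beta *: u in
  velocity_set g T beta alpha x u y w ->
  (1 - alpha * T) * gcomp g i x <=
  gcomp g i y + dot (grad (gcomp g i) y) (x + T *: w - y).
Proof.
move=> T0 y /(_ i) /=.
rewrite (_ : x + T *: w - y = T *: w - beta *: u); last first.
  by rewrite /y opprD addrACA subrr add0r.
rewrite dotDr dotNr [dot _ (T *: _)]dotZr.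
move: (dot _ w) (dot _ (beta *: u)) (gcomp g i x) (gcomp g i y) => A B gx gy.
rewrite -(ler_pM2l T0) mulrBr [T * (_ / T)]mulrC divfK ?gt_eqF //; lra.
Qed.

(** The quadratic terms of the step, divided by [M].  With [p = x - xs] and
[d = T u], the vector in the first norm is minus the displacement from
[y = x + (1 - 2 th) d] to [(1 - th) x + th xs], and the two subtracted terms come
from the strong convexity modulus [mu = 2 M s^2] at [xs] and at [x].
The relation [th = s / (1 + s)] makes the difference of the two sides an explicit
sum of squares. *)
Lemma momentum_potential (s th : R) p d : 0 < s <= 1 -> th = s / (1 + s) ->
  enorm (th *: p + (1 - 2 * th) *: d) ^+ 2
    - th * s ^+ 2 * enorm (p + (1 - 2 * th) *: d) ^+ 2
    - (1 - th) * (s * (1 - 2 * th)) ^+ 2 * enorm d ^+ 2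
  <= (1 - th) * enorm (th *: p + (1 - th) *: d) ^+ 2.
Proof.
move=> /andP[s0 s1] ->; have s10 : 1 + s != 0 by rewrite gt_eqF // addr_gt0.
rewrite -subr_ge0 !sqr_enorm.
set slack := (X in 0 <= X).
have -> : slack = s / (1 + s) ^+ 3 * (s ^+ 4 * (1 + s) * dot p p +
      s * (2 - s ^+ 2) * dot (s *: p + d) (s *: p + d) +
      (1 - s ^+ 2) ^+ 2 * dot d d).
  by rewrite /slack !dot_bilin (dotC d p); field.
have s2 : s ^+ 2 <= 1 by rewrite exprn_ile1 // ltW.
rewrite mulr_ge0 ?divr_ge0 ?exprn_ge0 ?addr_ge0 ?mulr_ge0 ?dot_ge0 ?subr_ge0
  ?exprn_ge0 ?(ltW s0) //; lra.
Qed.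

(** The potential contracts by [1 - th].  The inequality is the sum of the descent
inequality of the Lagrangian, the variational inequality [vi] of the projection,
the strong convexity inequalities [hx] and [hxs] with the weights [1 - th] and
[th], and [M] times [momentum_potential]. *)
Lemma accelerated_projected_step f g lam (M s th mu T delta : R) x0 xs x u w :
  convex_fun f -> (forall z, differentiable f z) ->
  (forall i, concave_fun (gcomp g i)) ->
  (forall i z, differentiable (gcomp g i) z) ->
  smooth M (lagrangian f g lam) ->
  feasible g xs -> (forall i, 0 <= lam i 0) ->
  (forall i, lam i 0 * gcomp g i xs = 0) ->
  0 < s <= 1 -> 2 * s ^+ 2 <= 1 -> th = s / (1 + s) -> mu = 2 * M * s ^+ 2 ->
  0 < M -> 0 < T -> 2 * M * T ^+ 2 = 1 -> delta * T = th ->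
  let beta := T * (1 - 2 * delta * T) in
  let y := x + beta *: u in
  let h := regularized f mu x0 in
  let l := lagrangian h g lam in
  is_argmin (velocity_set g T beta delta x u y)
            (velocity_objective h T delta u y) w ->
  l (x + T *: w) - l xs
    + M * enorm (th *: (x + T *: w - xs) + (1 - th) *: (T *: w)) ^+ 2 <=
  (1 - th) * (l x - l xs + M * enorm (th *: (x - xs) + (1 - th) *: (T *: u)) ^+ 2).
Proof.
move=> fc df gc dg lM fxs lam0 lamg s01 s2 thE muE M0 T0 MT dT beta y h l wmin.
have s0 : 0 < s by case/andP: s01.
have th0 : 0 <= th by rewrite thE divr_ge0 ?addr_ge0 ?ltW.
have th1 : th <= 1 by rewrite thE ler_pdivrMr ?addr_gt0 // mul1r lerDr.
have delta0 : 0 <= delta by rewrite -(pmulr_lge0 _ T0) dT.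
pose p := x - xs; pose d := T *: u; pose d' := T *: w; pose c := 1 - 2 * th.
pose G := grad h y.
have yE : y = x + c *: d.
  by rewrite /y /beta /d scalerA /c -dT mulrC mulrA.
have x'y : x + d' - y = d' - c *: d by rewrite yE opprD addrACA subrr add0r.
have xy : x - y = - (c *: d) by rewrite yE opprD addrA subrr sub0r.
have xsy : xs - y = - (p + c *: d) by rewrite yE /p opprD opprD opprB addrA.
(* Times [2 M T^2 = 1], the inequality between velocities becomes one between
   displacements, with the gradient term [G] free of any factor. *)
have vi : 0 <= 2 * M * dot (d' - c *: d) (- (th *: p) - d')
               + dot G (- (th *: p) - d').
  have dxs := velocity_set_contracting g T beta delta x u xs gc dg T0 delta0.
  rewrite dT in dxs; have {}dxs := dxs th1 fxs.
  case: (wmin) => Sw _.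
  have seg := velocity_set_segment _ _ _ _ _ _ _ _ _ Sw dxs.
  have wmin' : is_argmin (velocity_set g T beta delta x u y)
    (fun z => 1 / 2 * enorm (z + (- u + (2 * delta * T) *: u + T *: G)) ^+ 2) w.
    rewrite (_ : (fun z => _) = velocity_objective h T delta u y) //.
    by apply/funext => z; rewrite /velocity_objective !addrA.
  have := argmin_sqdist_variational _ _ _ _ seg wmin'.
  set a := w + _; set b := _ - w => ab.
  have -> : - (th *: p) - d' = T *: b.
    by rewrite /b /p /d' -dT; apply/matrixP => i j; rewrite !mxE; ring.
  have -> : d' - c *: d = T *: a - T ^+ 2 *: G.
    by rewrite /a /d /d' /c -dT; apply/matrixP => i j; rewrite !mxE; ring.
  rewrite dotDl dotNl !dotZl !dotZr.
  rewrite (_ : _ + _ = 2 * M * T ^+ 2 * dot a b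
                       + (1 - 2 * M * T ^+ 2) * T * dot G b); last by ring.
  by rewrite MT subrr !mul0r addr0 mul1r.
have hx := regularized_strongly_convex f mu x0 y x fc (df y).
have hxs := regularized_strongly_convex f mu x0 y xs fc (df y).
rewrite -/h -/G xy in hx; rewrite -/h -/G xsy in hxs.
(* Only the [h] part of the linear model of the Lagrangian survives; its [g] part
   is traded for the values of [g] at [x]. *)
have up : l (x + d') <= h y + dot G (d' - c *: d)
   + M * dot (d' - c *: d) (d' - c *: d) - (1 - th) * \sum_i lam i 0 * gcomp g i x.
  have lin := smooth_le_tangent M _ y (x + d') lM.
  rewrite dot_grad_lagrangian // in lin; last by case: lM.
  have lg : (1 - th) * \sum_i lam i 0 * gcomp g i x <= \sum_i lam i 0 * gcomp g i y
      + \sum_i lam i 0 * dot (grad (gcomp g i) y) (x + d' - y).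
    rewrite mulr_sumr -big_split /=; apply: ler_sum => i _.
    rewrite -mulrDr mulrCA; apply: ler_wpM2l => //; rewrite -dT.
    by apply: velocity_set_linearization T0 _; case: wmin.
  have muM : mu / 2 * dot (d' - c *: d) (d' - c *: d)
      <= M / 2 * dot (d' - c *: d) (d' - c *: d).
    rewrite ler_wpM2r ?dot_ge0 // ler_pM2r ?invr_gt0 // muE.
    by rewrite mulrAC ler_piMl ?(ltW M0).
  move: lin; rewrite /l !lagrangianE /h /G grad_regularized // /regularized.
  rewrite x'y in lg *; rewrite dotDl dotZl !sqr_enorm.
  have -> : x + d' - x0 = (y - x0) + (d' - c *: d).
    by rewrite -x'y [RHS]addrC addrA subrK.
  move: lg muM; move: (d' - _) (y - x0) => e r.
  rewrite (dotDl r) !(dotDr r) (dotC e r).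
  lra.
have lx : l x = h x - \sum_i lam i 0 * gcomp g i x by exact: lagrangianE.
have lxs : l xs = h xs.
  by rewrite /l lagrangianE big1 ?subr0 // => i _; rewrite lamg.
have pot := momentum_potential s th p d s01 thE.
rewrite (_ : x + T *: w - xs = p + d'); last by rewrite addrAC.
(* The new potential is centred at [x' - ((1 - th) x + th xs)]. *)
rewrite -/p -/d -/d' (_ : th *: (p + d') + (1 - th) *: d' = th *: p + d'); last first.
  by rewrite scalerDr -addrA -scalerDl subrKC scale1r.
have := ler_wpM2l th0 hxs; have := ler_wpM2l (ltW M0) pot.
have th1' : 0 <= 1 - th by rewrite subr_ge0.
have := ler_wpM2l th1' hx.
clearbody p d d' G.
rewrite lxs lx; move: up vi; rewrite muE /c !sqr_enorm !dot_bilin.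
rewrite (dotC d p) (dotC d' p) (dotC d' d).
lra.
Qed.

End Step.

(** * The rate *)

Section Rate.
Context {R : realType} {n ng : nat}.
Implicit Types (f : 'cV[R]_n -> R) (g : 'cV[R]_n -> 'cV[R]_ng).
Implicit Types (lam : 'cV[R]_ng).

(** Here [s^-1 = sqrt (2 kappa)], the square root of the condition number [2 M / mu]
that belongs to the step [1 / (2 M)]. *)
Lemma damping_step_size (M mu : R) : 0 < M -> 0 < mu ->
  let s := Num.sqrt (mu / (2 * M)) in
  [/\ 0 < s, s ^+ 2 = mu / (2 * M) & damping M mu * step_size M = s / (1 + s)].
Proof.
move=> M0 mu0 s.
have q0 : 0 < mu / (2 * M) by rewrite divr_gt0 ?mulr_gt0.
have s0 : 0 < s by rewrite sqrtr_gt0.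
split=> //; first by rewrite sqr_sqrtr ?ltW.
rewrite /damping /step_size.
have -> : Num.sqrt (2 * (M / mu)) = s^-1.
  by rewrite /s -sqrtrV ?ltW // invf_div mulrA.
have rt0 : 0 < Num.sqrt (2 * M) by rewrite sqrtr_gt0 mulr_gt0.
by field; rewrite !gt_eqF ?addr_gt0.
Qed.

(** The initial potential is at most the unregularized gap [l(x0) - l(xs)]: its
kinetic part [M th^2 |x0 - xs|^2] is absorbed by the regularization
[mu |xs - x0|^2 / 2 = M s^2 |xs - x0|^2] contained in [l_mu(xs)]. *)
Lemma regularized_run_gap f g lam (M : R) x0 xs (N : nat) (x u : nat -> 'cV[R]_n) :
  convex_fun f -> (forall z, differentiable f z) ->
  (forall i, concave_fun (gcomp g i)) ->
  (forall i z, differentiable (gcomp g i) z) ->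
  smooth M (lagrangian f g lam) ->
  feasible g xs -> (forall i, 0 <= lam i 0) ->
  (forall i, lam i 0 * gcomp g i xs = 0) ->
  0 < M -> 0 < reg_weight M N <= M ->
  regularized_run f g M x0 N x u ->
  lagrangian f g lam (x N) - lagrangian f g lam xs <=
  (1 - damping M (reg_weight M N) * step_size M) ^+ N * (lagrangian f g lam x0 - lagrangian f g lam xs)
  + reg_weight M N / 2 * enorm (xs - x0) ^+ 2.
Proof.
move=> fc df gc dg lM fxs lam0 lamg M0 /andP[mu0 muM] [x0E u0E step].
set mu := reg_weight M N in mu0 muM step *.
have [] := damping_step_size M mu M0 mu0; set s := Num.sqrt _ => s0 sE.
set l := lagrangian f g lam.
set th := s / (1 + s); set T := step_size M in step *.
set delta := damping M mu in step *; move=> dT; rewrite dT.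
have muE : mu = 2 * M * s ^+ 2 by rewrite sE; field; rewrite gt_eqF.
have s2 : 2 * s ^+ 2 <= 1 by rewrite -(ler_pM2r M0); lra.
have s1 : s <= 1.
  rewrite -(@ler_pXn2r _ 2) ?nnegrE ?ltW //; lra.
have rt0 : 0 < Num.sqrt (2 * M) by rewrite sqrtr_gt0 mulr_gt0.
have T0 : 0 < T by rewrite divr_gt0.
have MT : 2 * M * T ^+ 2 = 1.
  rewrite /T /step_size expr_div_n sqr_sqrtr ?mulr_ge0 ?(ltW M0) //.
  by field; rewrite gt_eqF.
pose h := regularized f mu x0; pose lr := lagrangian h g lam.
pose V k := lr (x k) - lr xs
  + M * enorm (th *: (x k - xs) + (1 - th) *: (T *: u k)) ^+ 2.
have th0 : 0 <= th by rewrite divr_ge0 ?addr_ge0 ?ltW.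
have th1 : 0 <= 1 - th.
  by rewrite subr_ge0 ler_pdivrMr ?addr_gt0 // mul1r lerDr.
have decay k : (k <= N)%N -> V k <= (1 - th) ^+ k * V 0%N.
  elim: k => [|k IH] kN; first by rewrite expr0 mul1r.
  rewrite exprS -mulrA; apply: le_trans (ler_wpM2l th1 (IH (ltnW kN))).
  have [wmin xS] := step k kN; rewrite /V xS.
  have s01 : 0 < s <= 1 by rewrite s0 s1.
  exact: (accelerated_projected_step f g lam M s th mu T delta x0 xs (x k) (u k)
    (u k.+1) fc df gc dg lM fxs lam0 lamg s01 s2 erefl muE M0 T0 MT dT wmin).
have lrE z : lr z = l z + mu * enorm (z - x0) ^+ 2 / 2.
  by rewrite /lr /l !lagrangianE /h /regularized addrAC.
have V0 : V 0%N <= l x0 - l xs.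
  rewrite /V x0E u0E !scaler0 addr0 !lrE subrr.
  have -> : enorm (th *: (x0 - xs)) ^+ 2 = th ^+ 2 * enorm (xs - x0) ^+ 2.
    by rewrite !sqr_enorm -(opprB xs) !dot_bilin; ring.
  have -> : enorm (0 : 'cV[R]_n) ^+ 2 = 0.
    by rewrite sqr_enorm dotE big1 // => i _; rewrite mxE mul0r.
  have thM : M * th ^+ 2 <= M * s ^+ 2.
    rewrite ler_wpM2l ?(ltW M0) // ler_pXn2r ?nnegrE ?(ltW s0) //.
    by rewrite ler_pdivrMr ?addr_gt0 // ler_peMr ?(ltW s0) // lerDl ltW.
  have := ler_wpM2r (exprn_ge0 2 (enorm_ge0 (xs - x0))) thM.
  rewrite muE; lra.
have VN := le_trans (decay N (leqnn N)) (ler_wpM2l (exprn_ge0 N th1) V0).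
have : 0 <= M * enorm (th *: (x N - xs) + (1 - th) *: (T *: u N)) ^+ 2.
  by rewrite mulr_ge0 ?exprn_ge0 ?enorm_ge0 ?(ltW M0).
have : 0 <= mu * enorm (x N - x0) ^+ 2.
  by rewrite mulr_ge0 ?exprn_ge0 ?enorm_ge0 ?(ltW mu0).
move: VN; rewrite /V !lrE; lra.
Qed.

Lemma ln_le_eighth (N : nat) : (128 <= N)%N -> ln (N%:R : R) <= N%:R / 8.
Proof.
move=> N128; have N0 : (128 : R) <= N%:R by rewrite ler_nat.
rewrite -ler_expR lnK ?posrE; last lra.
have := @expR_ge1Dxn R (N%:R / 8) 1.
rewrite -[(2`!)%:R]/(2 : R) => /(_ ltac:(lra)); nra.
Qed.

(** With [a = ln N / N] one has [s = sqrt 8 a], and [a <= 1 / 8] makes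
[s / (1 + s)] at least [2 a]; then [(1 - 2 a)^N <= exp (- 2 a N) = N^-2]. *)
Lemma contraction_rate (M : R) (N : nat) : 0 < M -> (128 <= N)%N ->
  0 <= (1 - damping M (reg_weight M N) * step_size M) ^+ N <= (N%:R ^+ 2)^-1.
Proof.
move=> M0 N128.
have N0 : 0 < (N%:R : R) by rewrite ltr0n (leq_trans _ N128).
pose a : R := ln (N%:R : R) / N%:R.
have a0 : 0 < a by rewrite divr_gt0 ?ln_gt0 // ltr1n (leq_trans _ N128).
have a8 : a <= 1 / 8 by rewrite ler_pdivrMr // mulrC mul1r ln_le_eighth.
have muE : reg_weight M N = 16 * M * a ^+ 2.
  by rewrite /reg_weight /a expr_div_n [RHS]mulrA.
have mu0 : 0 < reg_weight M N 
  by rewrite muE; apply: mulr_gt0; [lra|exact: exprn_gt0].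
have [] := damping_step_size M (reg_weight M N) M0 mu0.
set s := Num.sqrt _ => s0 s2 ->.
have {}s2 : s ^+ 2 = 8 * a ^+ 2 by rewrite s2 muE; field; rewrite gt_eqF.
have s10 : 0 < 1 + s by lra.
(* [8 / 3] is a rational lower bound of [sqrt 8], and [8 / 3 (1 - 2 a) >= 2]. *)
have sa : 8 / 3 * a <= s.
  have a1 : 0 <= 8 / 3 * a by lra.
  rewrite -(@ler_pXn2r _ 2) ?nnegrE ?(ltW s0) // s2 exprMn.
  have := sqr_ge0 a; lra.
have ths : 2 * a <= s / (1 + s) by rewrite ler_pdivlMr //; nra.
have th1 : 0 <= 1 - s / (1 + s) by rewrite subr_ge0 ler_pdivrMr // mul1r lerDr.
rewrite exprn_ge0 //=.
have -> : (N%:R ^+ 2)^-1 = expR (- (2 * a)) ^+ N :> R.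
  rewrite -expRM_natr (_ : - (2 * a) * N%:R = - (2 * ln N%:R)); last first.
    by rewrite /a; field; rewrite gt_eqF.
  by rewrite expRN (expRM_natl 2) lnK.
rewrite ler_pXn2r ?nnegrE ?expR_ge0 ?(leq_trans _ N128) //.
apply: le_trans (expR_ge1Dx _); lra.
Qed.

End Rate.

Theorem corollary6 (R : realType) (n ng : nat)
    (f : 'cV[R]_n -> R) (g : 'cV[R]_n -> 'cV[R]_ng)
    (L Lg Ll : R) (xs : 'cV[R]_n) (lam : 'cV[R]_ng) (x0 : 'cV[R]_n)
    (x u : nat -> nat -> 'cV[R]_n)
    (f_C2 : twice_cont_diff f)
    (g_C2 : forall i, twice_cont_diff (gcomp g i))
    (f_convex : convex_fun f)
    (f_smooth : smooth L f)
    (g_concave : forall i, concave_fun (gcomp g i))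
    (g_smooth : forall i, smooth Lg (gcomp g i))
    (f_coercive : coercive f)
    (C_compact : compact (feasible g))
    (C_nonempty : feasible g !=set0)
    (xs_min : is_argmin (feasible g) f xs)
    (lam_opt : optimal_multiplier f g xs lam)
    (hess_posdef :
       posdef (hess f xs - \sum_i lam i 0 *: hess (gcomp g i) xs))
    (l_smooth : smooth Ll (lagrangian f g lam))
    (run : forall N, (1 < N)%N -> regularized_run f g Ll x0 N (x N) (u N)) :
  exists2 r : nat -> R,
    r =O_\oo (fun N : nat => ln (N%:R : R) ^+ 2 / N%:R ^+ 2) &
    \forall N \near \oo,
      lagrangian f g lam (x N N) - lagrangian f g lam xs <= r N.
Proof.
have [fxs _] := xs_min; have [lam0 stat lamg] := lam_opt.
have df z : differentiable f z by case: f_C2.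
have dg i z : differentiable (gcomp g i) z by case: (g_C2 i).
set l := lagrangian f g lam.
have [Ll0|Ll0] := leP Ll 0.
  exists (fun=> 0).
    by apply/eqO_exP; exists 1 => //; apply: nearW => N; rewrite normr0 mul1r.
  apply: nearW => N; rewrite subr_le0.
  apply: le_trans (smooth_le_tangent _ _ xs _ l_smooth) _.
  rewrite dot_grad_lagrangian //; last by case: l_smooth.
  rewrite stat dot_suml; under [X in X - _]eq_bigr do rewrite dotZl.
  rewrite subrr addr0 gerDl mulr_le0_ge0 ?dot_ge0 // pmulr_lle0 //.
pose gap : R := `|l x0 - l xs|; pose D := 8 * Ll * enorm (xs - x0) ^+ 2.
have D0 : 0 <= D by rewrite !mulr_ge0 ?exprn_ge0 ?enorm_ge0 ?(ltW Ll0).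
exists (fun N => (gap + D * ln (N%:R : R) ^+ 2) / N%:R ^+ 2).
  (* [ln 2] serves as a lower bound of [ln N], to dominate [1 / N^2]. *)
  have ln2 : 0 < ln (2 : R) ^+ 2 by rewrite exprn_gt0 // ln_gt0 // ltr1n.
  apply/eqO_exP; exists (gap / ln 2 ^+ 2 + D + 1).
    by rewrite ltr_wpDl // addr_ge0 // divr_ge0 // ?normr_ge0 // ltW.
  near=> N.
  have N2 : (2 <= N)%N by near: N; exact: nbhs_infty_ge.
  have lnN : ln (2 : R) ^+ 2 <= ln (N%:R : R) ^+ 2.
    rewrite ler_pXn2r ?nnegrE ?ln_ge0 ?ler1n ?(leq_trans _ N2) //.
    by rewrite ler_ln ?posrE ?ltr0n ?ler_nat // (leq_trans _ N2).
  have gap0 : 0 <= gap := normr_ge0 _.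
  have lN0 : 0 <= ln (N%:R : R) ^+ 2 by exact: sqr_ge0.
  rewrite !ger0_norm; [|exact: divr_ge0|by rewrite divr_ge0 // addr_ge0 // mulr_ge0].
  rewrite [leRHS]mulrA ler_wpM2r ?invr_ge0 ?sqr_ge0 //.
  have : gap <= gap / ln 2 ^+ 2 * ln (N%:R : R) ^+ 2.
    by rewrite mulrAC ler_pdivlMr // ler_wpM2l // normr_ge0.
  lra.
near=> N.
have N128 : (128 <= N)%N by near: N; exact: nbhs_infty_ge.
have N1 : (1 < N)%N by exact: leq_trans N128.
have N0 : 0 < (N%:R : R) by rewrite ltr0n ltnW.
have muE : reg_weight Ll N = 16 * Ll * (ln (N%:R : R) / N%:R) ^+ 2.
  by rewrite /reg_weight expr_div_n [RHS]mulrA.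
have ln0 : 0 < ln (N%:R : R) by rewrite ln_gt0 // ltr1n.
have mu0 : 0 < reg_weight Ll N <= Ll.
  rewrite muE; apply/andP; split.
    by apply: mulr_gt0; [lra|rewrite exprn_gt0 // divr_gt0].
  have a8 : ln (N%:R : R) / N%:R <= 1 / 8.
    by rewrite ler_pdivrMr // mulrC mul1r ln_le_eighth.
  have a0 : 0 < ln (N%:R : R) / N%:R by rewrite divr_gt0.
  rewrite mulrAC ler_piMl ?(ltW Ll0) //; nra.
apply: le_trans (regularized_run_gap _ _ _ _ _ _ _ _ _ f_convex df g_concave dg
  l_smooth fxs lam0 lamg Ll0 mu0 (run N N1)) _.
have /andP[r0 rN] := contraction_rate Ll N Ll0 N128.
rewrite -/l mulrDl lerD //; last first.
  by rewrite /reg_weight /D le_eqVlt; apply/orP; left; apply/eqP; field; rewrite gt_eqF.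
apply: le_trans (ler_wpM2l r0 (ler_norm _)) _.
by rewrite mulrC ler_wpM2l.
Unshelve. all: by end_near. Qed.
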